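(* Let $S$ be a positive semiring and $0 \in \operatorname{pcomp}(S)$. Then the following statements are equivalent: (1) $1\in \operatorname{Stone}(S)$. (2) $0^* = 1$. (3) $1$ is the largest element of $S$. (4) $S$ is a simple semiring.
   Context: A semiring is a set $S$ with operations $+,\cdot$ such that $(S,+)$ is a commutative monoid with identity $0$, $(S,\cdot)$ is a commutative monoid with identity $1\neq 0$, multiplication distributes over addition, and $s\cdot 0=0$ for all $s\in S$. A semiring is simple if $1+s=1$ for all $s\in S$. An ordered semiring is a semiring with a partial order $\leq$ such that $s\leq t$ implies $s+u\leq t+u$ for all $u$, and $s\leq t$, $0\leq u$ imply $su\leq tu$. It is positive if $0\leq s$ for all $s\in S$. In an ordered semiring $S$, an element $s$ is pseudocomplemented if there is an element $s^*\in S$ (necessarily unique, called the pseudocomplement of $s$) such that $ss^*=0$ and, for each $x\in S$, $sx=0$ implies $x\leq s^*$. $\operatorname{pcomp}(S)$ is the set of pseudocomplemented elements of $S$. Write $s^{**}=(s^* )^*$ when it exists. For $S$ positive, $s\in S$ is a Stone element if $s,s^*\in\operatorname{pcomp}(S)$ and $s^*+s^{**}=1$; $\operatorname{Stone}(S)$ is the set of Stone elements. *)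

(* Defs.v *)
From HB Require Import structures.
From mathcomp Require Import all_boot all_algebra.
From mathcomp Require Import boolp classical_sets.

Set Implicit Arguments.
Unset Strict Implicit.
Unset Printing Implicit Defensive.

Import GRing.Theory.

Local Open Scope classical_set_scope.
Local Open Scope ring_scope.

(* The order is a field of its own rather than an [Order.POrder] structure:
   a common descendant of [Order.POrder] and [GRing.ComNzSemiRing] is rejected
   by HB, for lack of the joins with the hierarchy of [Num.POrderedZmodule]. *)
HB.mixin Record isOrderedSemiRing S of GRing.ComNzSemiRing S := {
  sle : rel S;
  sle_refl : reflexive sle;
  sle_anti : antisymmetric sle;
  sle_trans : transitive sle;
  sle_wD2r : forall s t u : S, sle s t -> sle (s + u) (t + u);
  sle_wpM2r : forall s t u : S, sle s t -> sle 0 u -> sle (s * u) (t * u)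
}.

#[short(type="orderedSemiRingType")]
HB.structure Definition OrderedSemiRing :=
  { S of isOrderedSemiRing S & GRing.ComNzSemiRing S }.

Section Defs.
Context (S : orderedSemiRingType).
Implicit Types s t x : S.

Definition positive_semiring : Prop := forall s, sle 0 s.

Definition simple_semiring : Prop := forall s, 1 + s = 1.

Definition largest t : Prop := forall s, sle s t.

Definition is_pseudocomplement s t : Prop :=
  s * t = 0 /\ forall x, s * x = 0 -> sle x t.

Definition pseudocomplemented : set S :=
  [set s | exists t, is_pseudocomplement s t].

(* Total version of s |-> s^*; meaningful only on [pseudocomplemented],
   with junk value 0 elsewhere. *)
Definition pstar s : S := xget 0 [set t | is_pseudocomplement s t].

Definition Stone : set S :=
  [set s | [/\ s \in pseudocomplemented, pstar s \in pseudocomplemented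
             & pstar s + pstar (pstar s) = 1]].

Lemma is_pseudocomplement_uniq s t1 t2 :
  is_pseudocomplement s t1 -> is_pseudocomplement s t2 -> t1 = t2.
Proof.
move=> [h1 m1] [h2 m2]; apply: sle_anti.
by rewrite m2 // m1.
Qed.

Lemma pstarP s : s \in pseudocomplemented -> is_pseudocomplement s (pstar s).
Proof. by rewrite in_setE => /(xgetPex 0). Qed.

Lemma pstarE s t : is_pseudocomplement s t -> pstar s = t.
Proof.
move=> st; apply: xget_unique => // y sy.
exact: is_pseudocomplement_uniq sy st.
Qed.

End Defs.

Arguments pseudocomplemented : clear implicits.
Arguments Stone : clear implicits.

(* Main.v *)
Require Import Defs.
From mathcomp Require Import all_boot all_algebra.
From mathcomp Require Import boolp classical_sets.

Local Open Scope ring_scope.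

Import GRing.Theory.

(** Always [1^* = 0], so [1^* + 1^** = 0 + 0^* = 0^*], and the Stone identity at [1] says exactly
    [0^* = 1]. Since [0] annihilates everything, [0^*] is the top element ([is_pseudocomplement0]).
    Positivity gives [s <= 1 + s] and [1 <= 1 + s] ([sle_addl]), so [1] is the top exactly when
    every [1 + s] collapses to [1]. *)

Lemma is_pseudocomplement1 (S : orderedSemiRingType) :
  is_pseudocomplement (1 : S) 0.
Proof. by split=> [|x]; rewrite mul1r // => ->; apply: sle_refl. Qed.

(** The condition [0 * x = 0] holds for every [x], so maximality among annihilators of [0] is
    maximality in [S]. *)
Lemma is_pseudocomplement0 (S : orderedSemiRingType) (t : S) :
  is_pseudocomplement 0 t <-> largest t.
Proof.
split=> [[_ t_max] s|t_max]; first by apply: t_max; rewrite mul0r.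
by split=> [|x _]; [rewrite mul0r | apply: t_max].
Qed.

Lemma sle_addl (S : orderedSemiRingType) (s t : S) :
  positive_semiring S -> sle s (t + s).
Proof. by move=> S_positive; rewrite -{1}(add0r s); apply: sle_wD2r. Qed.

Theorem proposition2p12 (S : orderedSemiRingType)
    (S_positive : positive_semiring S)
    (pcomp0 : (0 : S) \in pseudocomplemented S) :
  [<-> (1 : S) \in Stone S;
       pstar (0 : S) = 1;
       largest (1 : S);
       simple_semiring S].
Proof.
have pstar1 : pstar (1 : S) = 0 := pstarE (is_pseudocomplement1 S).
tfae.
- by rewrite in_setE => -[_ _]; rewrite pstar1 add0r.
(* [pcomp0] ensures that [pstar 0] is a genuine pseudocomplement, not the default value. *)
- by move=> pstar0; apply/is_pseudocomplement0; rewrite -pstar0; apply: pstarP.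
- move=> one_max s; apply: sle_anti; rewrite one_max /= addrC.
  exact: sle_addl.
- move=> S_simple.
  have pstar0 : pstar (0 : S) = 1.
    apply: pstarE; apply/is_pseudocomplement0 => s.
    by rewrite -(S_simple s); apply: sle_addl.
  (* With [1^* = 0], the second Stone condition becomes [pcomp0] and the third [0 + 1 = 1]. *)
  rewrite in_setE; split; rewrite ?pstar1 ?pstar0 ?add0r //.
  by rewrite in_setE; exists 0; apply: is_pseudocomplement1.
Qed.
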